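(* Let $(\mathcal{R},\mu)$ be a $\sigma$-finite resonant measure space, let $\phi\colon\mathcal{R}\to\mathcal{R}$ be measurable, and let $T_\phi f=f\circ\phi$. Then the following three statements are equivalent: (i) $\phi$ is power-measure-bounded, i.e. there is some $A\in(0,\infty)$ such that $\mu(\phi^{-n}(E))\le A\,\mu(E)$ for every $n\in\mathbb{N}$, $n\ge1$, and every measurable $E\subseteq\mathcal{R}$. (ii) $T_\phi\colon L^1\to L^1$ is power-bounded. (iii) $T_\phi\colon X\to X$ is power-bounded for every rearrangement-invariant quasi-Banach function space $X$ over $(\mathcal{R},\mu)$.
   Context: $\mathcal{M}=\mathcal{M}(\mathcal{R},\mu)$ is the set of extended complex-valued $\mu$-measurable functions (identified when equal $\mu$-a.e.), $\mathcal{M}_+$ the non-negative ones. For $f\in\mathcal{M}$, $f_*(s)=\mu(\{|f|>s\})$ and $f^*(t)=\inf\{s\ge0:f_*(s)\le t\}$. A $\sigma$-finite $(\mathcal{R},\mu)$ is resonant if $\sup_{\tilde g^*=g^*}\int_{\mathcal{R}}|f\tilde g|\,d\mu=\int_0^\infty f^*g^*\,d\lambda$ for all $f,g\in\mathcal{M}$ ($\lambda$ Lebesgue measure; equivalently, it is non-atomic, or completely atomic with all atoms of equal measure). A quasi-Banach function norm is a map $\lVert\cdot\rVert\colon\mathcal{M}\to[0,\infty]$ with $\lVert\,|f|\,\rVert=\lVert f\rVert$ whose restriction to $\mathcal{M}_+$ satisfies: (Q1) it is absolutely homogeneous, vanishes exactly at $f=0$ a.e., and there is $C\ge1$ with $\lVert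 f+g\rVert\le C(\lVert f\rVert+\lVert g\rVert)$; (P2) $f\le g$ a.e. implies $\lVert f\rVert\le\lVert g\rVert$; (P3) $f_n\uparrow f$ a.e. implies $\lVert f_n\rVert\uparrow\lVert f\rVert$; (P4) $\lVert\chi_E\rVert<\infty$ if $\mu(E)<\infty$. It is rearrangement-invariant if $f^*=g^*$ implies $\lVert f\rVert=\lVert g\rVert$. The corresponding space is $X=\{f\in\mathcal{M}:\lVert f\rVert_X<\infty\}$. $\phi^{-n}(E)$ is the preimage of $E$ under the $n$-fold composition $\phi^n$. Power-boundedness of $T_\phi$ on $X$ means that $T_\phi$ is a well-defined continuous operator $X\to X$ (on a.e.-equivalence classes) and the iterates $\{T_\phi^n:n\in\mathbb{N}\}$ are equicontinuous, i.e. $\sup_n\lVert T_\phi^n\rVert_{X\to X}<\infty$. *)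

(* Defs.v *)
From HB Require Import structures.
From mathcomp Require Import all_boot all_order all_algebra.
From mathcomp Require Import complex.
From mathcomp Require Import all_classical all_reals all_analysis.
From mathcomp Require Import measurable_realfun.
Set Implicit Arguments. Unset Strict Implicit. Unset Printing Implicit Defensive.
Import Order.TTheory GRing.Theory Num.Theory.
Import numFieldNormedType.Exports.
Local Open Scope classical_set_scope.
Local Open Scope ring_scope.
Local Open Scope ereal_scope.

(* The extended complex numbers are the Riemann sphere: [None] is infinity.
   [R[i]^o] is [R[i]] carrying its usual (norm) topology. *)
Definition ecomplex (R : realType) : Type :=
  one_point_compactification R[i]^o.

Definition borel_ecomplex (R : realType) :=
  g_sigma_algebraType
    (open : set (set (one_point_compactification R[i]^o))).

Definition eabs (R : realType) (z : ecomplex R) : \bar R :=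
  if z is Some w then (ComplexField.Normc.normc w)%:E else +oo.

(* Only meant for x in [0, +oo]; -oo also goes to infinity. *)
Definition of_ereal (R : realType) (x : \bar R) : ecomplex R :=
  if x is r%:E then Some (r%:C)%C else None.

Section function_norms.
Context (d : measure_display) (T : measurableType d) (R : realType).
Variable mu : {measure set T -> \bar R}.
Implicit Types (f g : T -> ecomplex R) (N : (T -> ecomplex R) -> \bar R).

(* Elements of M are represented by functions; the identification of functions
   that agree a.e. is made explicit wherever it matters. *)
Definition Mfun f : Prop :=
  measurable_fun [set: T] (f : T -> borel_ecomplex R).

(* The non-negative functions of M, with values in [0, +oo]; such an [f] is
   viewed in M through [of_ereal \o f]. *)
Definition Mplus (f : T -> \bar R) : Prop :=
  measurable_fun [set: T] f /\ forall x, 0 <= f x.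

Definition distribution_fun f (s : R) : \bar R :=
  mu [set x | s%:E < eabs (f x)].

Definition rearrangement f (t : R) : \bar R :=
  ereal_inf [set s%:E | s in
    [set s : R | (0 <= s)%R /\ distribution_fun f s <= t%:E]].

(* f^* = g^*, both being functions on [0, +oo[ *)
Definition equimeasurable f g : Prop :=
  forall t : R, (0 <= t)%R -> rearrangement f t = rearrangement g t.

(* |f h| is read as |f| |h|, with the convention 0 * +oo = 0. *)
Definition resonant : Prop :=
  forall f g, Mfun f -> Mfun g ->
    ereal_sup [set \int[mu]_x (eabs (f x) * eabs (h x)) | h in
      [set h | Mfun h /\ equimeasurable h g]] =
    \int[lebesgue_measure]_(t in `[0%R, +oo[)
      (rearrangement f t * rearrangement g t).

(* [N] is only constrained on M.  That it is compatible with a.e. equality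
   follows from [qn_abs] and [qn_P2]. *)
Record quasi_banach_norm N : Prop := {
  qn_ge0 : forall f, Mfun f -> 0 <= N f ;
  qn_abs : forall f, Mfun f -> N (@of_ereal R \o (@eabs R \o f)) = N f ;
  qn_homo : forall (a : R) (f : T -> \bar R), (0 <= a)%R -> Mplus f ->
    N (@of_ereal R \o (fun x => a%:E * f x)) = a%:E * N (@of_ereal R \o f) ;
  qn_eq0 : forall f : T -> \bar R, Mplus f ->
    (N (@of_ereal R \o f) = 0 <-> {ae mu, forall x, f x = 0}) ;
  qn_triangle : exists C : R, (1 <= C)%R /\
    forall f g : T -> \bar R, Mplus f -> Mplus g ->
      N (@of_ereal R \o (fun x => f x + g x)) <=
      C%:E * (N (@of_ereal R \o f) + N (@of_ereal R \o g)) ;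
  qn_P2 : forall f g : T -> \bar R, Mplus f -> Mplus g ->
    {ae mu, forall x, f x <= g x} ->
    N (@of_ereal R \o f) <= N (@of_ereal R \o g) ;
  qn_P3 : forall (u : nat -> T -> \bar R) (f : T -> \bar R),
    (forall n, Mplus (u n)) -> Mplus f ->
    {ae mu, forall x, nondecreasing_seq (fun n => u n x) /\
                      u n x @[n --> \oo] --> f x} ->
    nondecreasing_seq (fun n => N (@of_ereal R \o u n)) /\
    N (@of_ereal R \o u n) @[n --> \oo] --> N (@of_ereal R \o f) ;
  qn_P4 : forall E : set T, measurable E -> mu E < +oo ->
    N (@of_ereal R \o (fun x => (\1_E x)%:E)) < +oo
}.

Definition rearrangement_invariant N : Prop :=
  forall f g, Mfun f -> Mfun g -> equimeasurable f g -> N f = N g.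

Definition space N : set (T -> ecomplex R) := [set f | Mfun f /\ N f < +oo].

Definition L1norm f : \bar R := \int[mu]_x eabs (f x).

Definition opnorm N (S : (T -> ecomplex R) -> (T -> ecomplex R)) : \bar R :=
  ereal_sup [set N (S f) | f in [set f | space N f /\ N f <= 1]].

(* [S] is meant to be linear, so that the finiteness of the supremum contains
   both the continuity of [S] and the equicontinuity of its iterates. *)
Record power_bounded N (S : (T -> ecomplex R) -> (T -> ecomplex R)) : Prop := {
  pb_ae : forall f g, space N f -> space N g ->
    {ae mu, forall x, f x = g x} -> {ae mu, forall x, S f x = S g x} ;
  pb_space : forall f, space N f -> space N (S f) ;
  pb_sup : ereal_sup [set opnorm N (iter n S) | n in [set: nat]] < +oo
}.

Definition composition_operator (phi : T -> T) f : T -> ecomplex R := f \o phi.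

Definition power_measure_bounded (phi : T -> T) : Prop :=
  exists A : R, (0 < A)%R /\
    forall (n : nat) (E : set T), (1 <= n)%N -> measurable E ->
      mu (iter n phi @^-1` E) <= A%:E * mu E.

End function_norms.

(* Main.v *)
Require Import Defs.
From HB Require Import structures.
From mathcomp Require Import all_boot all_order all_algebra.
From mathcomp Require Import complex.
From mathcomp Require Import all_classical all_reals all_analysis.
From mathcomp Require Import measurable_realfun.
Import Order.TTheory GRing.Theory Num.Theory.
Import numFieldNormedType.Exports.
Local Open Scope classical_set_scope.
Local Open Scope ring_scope.
Set Implicit Arguments.
Unset Strict Implicit.
Unset Printing Implicit Defensive.

(** The heart of the matter is that power-measure-boundedness implies uniform
boundedness of the iterates on every rearrangement-invariant space; $L^1$ is
one of these spaces, and indicator functions in $L^1$ recover the measure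
estimate. So each of the three statements yields (i), which yields the other
two.

Let psi be an iterate of phi, with mu(psi^-1 E) <= k mu(E) for all E, and let
f = sum_v v 1_(B_v) be simple with level sets B_v of finite measure. Then
f o psi = sum_v v 1_(S_v), where S_v = psi^-1 B_v has measure at most
k mu(B_v). Suppose that S_v can be covered by k subsets Q_(v,i), each of which
has a copy of the same measure P_(v,i) inside B_v. For fixed i the functions
f_i = sum_v v 1_(Q_(v,i)) and h_i = sum_v v 1_(P_(v,i)) have the same
distribution and h_i <= f, hence N(f_i) = N(h_i) <= N(f). As
f o psi <= f_0 + ... + f_(k-1), the quasi-triangle inequality bounds N(f o psi)
by a multiple of N(f) which depends only on k and N ([ri_simple_comp_le]).
Monotone approximation extends the bound to all of M ([ri_comp_le]).

The copies come from resonance, with no case distinction between non-atomic and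
atomic spaces. Tested on two indicators 1_E and 1_F with mu(F) <= mu(E) < oo,
the resonance identity gives sets F' with mu(F') = mu(F) that lie in E up to a part
F' \ E of arbitrarily small measure. That defect is again the measure of a set,
and it fits into what is left of E, so the step can be iterated; the pieces
found fill a subset of E whose measure is exactly mu(F) ([resonant_subset]).
Greedy splitting then gives the covers ([split_copies]).

Resonance also shows that $L^1$ is rearrangement-invariant: tested against the
constant 1 it expresses the integral of |f| through f^* ([resonant_L1norm]). *)

(** * Measurability on the Riemann sphere *)

Section extended_complex.
Local Open Scope ereal_scope.
Context (R : realType).

Lemma eabs_ge0 (z : ecomplex R) : 0 <= eabs z.
Proof.
case: z => [w|] /=; last exact: leey.
by rewrite lee_fin; case: w => a b; exact: sqrtr_ge0.
Qed.

Lemma eabs_of_ereal (x : \bar R) : 0 <= x -> eabs (of_ereal x) = x.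
Proof.
case: x => [r| |] //=; rewrite lee_fin => r0.
by rewrite expr0n/= addr0 sqrtr_sqr ger0_norm.
Qed.

Lemma open_normc_lt (r : R) :
  open [set w : R[i]^o | (ComplexField.Normc.normc w < r)%R].
Proof.
rewrite openE => w /= wr; apply/nbhs_ballP.
exists (r - ComplexField.Normc.normc w)%:C%C.
  by rewrite /= ltcR subr_gt0.
move=> v; rewrite -ball_normE /= => wv.
have {}wv : (ComplexField.Normc.normc (w - v) < r - ComplexField.Normc.normc w)%R.
  by rewrite -ltcR.
have vE : (v = v - w + w :> R[i])%R by rewrite subrK.
have : (`|v| <= `|v - w| + `|w| :> R[i])%R by rewrite {1}vE; exact: ler_normD.
rewrite -(distrC w v) -rmorphD lecR => /le_lt_trans; apply.
by rewrite -ltrBrDr.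
Qed.

(** No compactness of discs is needed: a closed disc is a countable
intersection of open discs, which remain open in the compactification, and the
sets where |z| > r are the complements of the closed discs. *)
Lemma measurable_eabs : measurable_fun [set: borel_ecomplex R] (@eabs R).
Proof.
apply: (measurability _ (ErealGenOInfty.measurableE R)) => _ [_ [r ->] <-].
rewrite setTI.
have -> : (@eabs R) @^-1` `]r%:E, +oo[ = ~` \bigcap_n
   (Some @` [set w : R[i]^o | (ComplexField.Normc.normc w < r + n.+1%:R^-1)%R]
      : set (borel_ecomplex R)).
  apply/seteqP; split => [z /=|z].
    rewrite in_itv /= andbT => rz zn; have [w /= _ zw] := zn O I.
    move: rz; rewrite -zw /= lte_fin; apply/negP; rewrite -leNgt.
    apply/ler_addgt0Pr => e e0.
    have := truncnS_gt e^-1%R.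
    set n := Num.truncn _ => en.
    have [w' /= w'n] := zn n I.
    rewrite -zw => -[ww']; rewrite -ww'; apply/ltW/(lt_le_trans w'n).
    by rewrite lerD2l invf_ple// ?posrE// ltW.
  rewrite /= in_itv /= andbT ltNge => zn; apply/negP => zr; apply: zn => n _.
  case: z zr => [w|//] /=; rewrite lee_fin => wr; exists w => //=.
  by rewrite (le_lt_trans wr)// ltrDl.
apply: measurableC; apply: bigcap_measurable => // n _.
apply: sub_sigma_algebra.
exact/one_point_compactification_open_some/open_normc_lt.
Qed.

(** The preimage of an open set is an open subset of the real line, together with
both infinite points if the set contains infinity. *)
Lemma measurable_of_ereal :
  measurable_fun [set: \bar R] (@of_ereal R : \bar R -> borel_ecomplex R).
Proof.
apply: (@measurability _ _ _ (borel_ecomplex R) _ _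
  (open : set (set (one_point_compactification R[i]^o)))) => //.
move=> _ [U oU <-]; rewrite setTI.
have -> : @of_ereal R @^-1` U = (EFin @` [set r : R | U (Some (r%:C)%C)]) `|`
    [set x : \bar R | U None /\ (x = +oo \/ x = -oo)].
  apply/seteqP; split => [[r| |] /=|x /=].
  - by move=> Ur; left; exists r.
  - by move=> UN; right; split => //; left.
  - by move=> UN; right; split => //; right.
  - by move=> [[r ? <-]//|[UN [|] ->]].
apply: measurableU.
  apply: measurable_image_EFin; apply: open_measurable.
  have : open ((Some : R[i]^o -> one_point_compactification R[i]^o) @^-1` U).
    by move/continuousP : (@one_point_compactification_some_continuous R[i]^o); exact.
  rewrite !openE => oV r /oV /nbhs_ballP [e /= e0 eV].
  apply/nbhs_ballP; exists (complex.Re e) => /=.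
    by move: e0; rewrite ltcE => /andP[].
  move=> s; rewrite -ball_normE /= => rs; apply: eV.
  rewrite -ball_normE /= -rmorphB.
  move: e0; rewrite ltcE => /andP[/eqP/= eI eR].
  by rewrite ltcE /= eI eqxx/= expr0n /= addr0 sqrtr_sqr.
have [UN|UN] := pselect (U None).
  rewrite (_ : [set _ | _] = [set +oo] `|` [set -oo]); first exact: measurableU.
  by apply/seteqP; split => [x [_ []]|x []] /=; tauto.
by rewrite (_ : [set _ | _] = set0)// -subset0 => x [].
Qed.

End extended_complex.

(** * Rearrangements and distribution functions *)

Section rearrangements.
Local Open Scope ereal_scope.
Context (d : measure_display) (T : measurableType d) (R : realType).
Variable mu : {measure set T -> \bar R}.
Implicit Types (f g h : T -> ecomplex R) (E F : set T).

Lemma Mfun_eabs f : Mfun f -> measurable_fun [set: T] (@eabs R \o f).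
Proof. by move=> mf; exact: (measurableT_comp (@measurable_eabs R) mf). Qed.

Lemma Mfun_of_ereal (f : T -> \bar R) :
  measurable_fun [set: T] f -> Mfun (@of_ereal R \o f).
Proof. by move=> mf; exact: (measurableT_comp (@measurable_of_ereal R) mf). Qed.

Lemma Mplus_eabs f : Mfun f -> Mplus (@eabs R \o f).
Proof. by move=> mf; split=> [|x]; [exact: Mfun_eabs|exact: eabs_ge0]. Qed.

Lemma measurable_superlevel f (s : R) :
  Mfun f -> measurable [set x | s%:E < eabs (f x)].
Proof.
move=> /Mfun_eabs mf; rewrite -[X in measurable X]setTI.
exact: emeasurable_fun_o_infty.
Qed.

Lemma distribution_fun_anti f (s t : R) : Mfun f -> (s <= t)%R ->
  distribution_fun mu f t <= distribution_fun mu f s.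
Proof.
move=> mf st; apply: le_measure; rewrite ?inE; try exact: measurable_superlevel.
by move=> x /=; apply: le_lt_trans; rewrite lee_fin.
Qed.

(** The Galois connection between f^* and f_*; the nontrivial direction is
the right-continuity of f_*, that is, continuity of mu from below. *)
Lemma rearrangement_le f (s t : R) : Mfun f -> (0 <= s)%R ->
  (rearrangement mu f t <= s%:E) = (distribution_fun mu f s <= t%:E).
Proof.
move=> mf s0; apply/idP/idP => [fs|fs]; last first.
  by apply: ereal_inf_lbound; exists s.
have lev (n : nat) : distribution_fun mu f (s + n.+1%:R^-1) <= t%:E.
  have : rearrangement mu f t < (s + n.+1%:R^-1)%:E.
    by rewrite (le_lt_trans fs)// lte_fin ltrDl.
  move=> /ereal_inf_lt [_ [r [r0 fr] <-]]; rewrite lte_fin => rs.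
  by rewrite (le_trans _ fr)// distribution_fun_anti// ltW.
have mE n := measurable_superlevel (s + n.+1%:R^-1) mf.
rewrite /distribution_fun (_ : [set x | _] =
    \bigcup_n [set x | (s + n.+1%:R^-1)%:E < eabs (f x)]); last first.
  apply/seteqP; split => [x /= sx|x [n _ /=]]; last first.
    by apply: le_lt_trans; rewrite lee_fin lerDl.
  have [r rx sr] : exists2 r : R, r%:E <= eabs (f x) & (s < r)%R.
    case: (eabs (f x)) sx => [r| |] //=; first by rewrite lte_fin; exists r.
    by move=> _; exists (s + 1)%R; rewrite ?leey// ltrDl.
  have := truncnS_gt (r - s)^-1; set n := Num.truncn _ => rn.
  exists n => //=; apply: lt_le_trans rx; rewrite lte_fin -ltrBrDl.
  by rewrite invf_plt ?posrE ?subr_gt0 ?ltr0n.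
have mucvg : mu \o (fun n => [set x | (s + n.+1%:R^-1)%:E < eabs (f x)]) @ \oo -->
   mu (\bigcup_n [set x | (s + n.+1%:R^-1)%:E < eabs (f x)]).
  apply: nondecreasing_cvg_mu => //; first exact: bigcup_measurable.
  move=> m n mn; apply/subsetPset => x /=; apply: le_lt_trans.
  by rewrite lee_fin lerD2l lef_pV2 ?posrE// ler_nat.
rewrite -(cvg_lim _ mucvg)//; apply: lime_le; first by apply/cvg_ex; eexists; exact: mucvg.
by apply: nearW => n; exact: lev.
Qed.

(** No information is lost in passing from f_* to f^*: by [rearrangement_le],
f^* determines which real numbers are upper bounds of f_*(s). *)
Lemma equimeasurable_distribution f g (s : R) : Mfun f -> Mfun g ->
  equimeasurable mu f g -> (0 <= s)%R ->
  distribution_fun mu f s = distribution_fun mu g s.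
Proof.
move=> mf mg fg s0.
have le_iff (t : R) : (0 <= t)%R ->
    (distribution_fun mu f s <= t%:E) = (distribution_fun mu g s <= t%:E).
  by move=> t0; rewrite -!rearrangement_le// fg.
(* A value in [0, +oo] is determined by its real upper bounds. *)
have le_test (a b : \bar R) : 0 <= b ->
    (forall t : R, (0 <= t)%R -> b <= t%:E -> a <= t%:E) -> a <= b.
  case: b => [r r0 /(_ r)|_ _|//]; last exact: leey.
  by apply => //; rewrite -lee_fin.
apply/eqP; rewrite eq_le; apply/andP; split; apply: le_test => [|t t0];
  by rewrite ?measure_ge0// le_iff.
Qed.

Lemma distribution_equimeasurable f g :
  (forall s : R, (0 <= s)%R -> distribution_fun mu f s = distribution_fun mu g s) ->
  equimeasurable mu f g.
Proof.
move=> fg t t0; congr ereal_inf; congr image.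
by apply/seteqP; split => s /= [s0]; [rewrite fg|rewrite -fg].
Qed.

Lemma rearrangement_ge0 f (t : R) : 0 <= rearrangement mu f t.
Proof. by apply: le_ereal_inf_tmp => _ [s [s0 _] <-]; rewrite lee_fin. Qed.

Definition indicator E : T -> ecomplex R := @of_ereal R \o (fun x => (\1_E x)%:E).

Lemma eabs_indicator E x : eabs (indicator E x) = (\1_E x)%:E.
Proof. by rewrite eabs_of_ereal// lee_fin. Qed.

Lemma Mfun_indicator E : measurable E -> Mfun (indicator E).
Proof.
by move=> mE; apply: Mfun_of_ereal; apply/measurable_EFinP; exact: measurable_indic.
Qed.

Lemma distribution_indicator E (s : R) : (0 <= s)%R ->
  distribution_fun mu (indicator E) s = if (s < 1)%R then mu E else 0.
Proof.
move=> s0; rewrite /distribution_fun.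
under eq_set do rewrite eabs_indicator lte_fin indicE.
case: ifPn => [s1|]; last rewrite -leNgt => s1.
  rewrite (_ : [set _ | _] = E)//; apply/seteqP; split => [x /=|x Ex /=].
    by case: (boolP (x \in E)) => [/set_mem//|_]; rewrite ltNge s0.
  by rewrite mem_set.
rewrite (_ : [set _ | _] = set0)// -subset0 => x /=; apply/negP; rewrite -leNgt.
by case: (x \in E).
Qed.

Lemma rearrangement_indicator E (t : R) : measurable E -> (0 <= t)%R ->
  rearrangement mu (indicator E) t = if t%:E < mu E then 1 else 0.
Proof.
move=> mE t0; have mi := Mfun_indicator mE.
have le1 : rearrangement mu (indicator E) t <= 1.
  by rewrite rearrangement_le// distribution_indicator// ltxx lee_fin.
apply/eqP; rewrite eq_le; case: ifPn => [tE|]; last rewrite -leNgt => tE.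
  rewrite le1 /= ; apply: le_ereal_inf_tmp => _ [s [s0 sE] <-].
  rewrite lee_fin leNgt; apply/negP => s1; move: sE.
  by rewrite distribution_indicator// s1 leNgt tE.
by rewrite rearrangement_ge0 rearrangement_le// distribution_indicator// ltr01 tE.
Qed.

End rearrangements.

(** * Subsets of prescribed measure in a resonant space *)

Section resonant_copies.
Local Open Scope ereal_scope.
Context (d : measure_display) (T : measurableType d) (R : realType).
Variable mu : {measure set T -> \bar R}.
Hypothesis hmu : resonant mu.
Implicit Types (f g h : T -> ecomplex R) (E F S B : set T).

(** Resonance applied to the indicators of E and F: the integral of the product
of the rearrangements is mu(F), and a function h equimeasurable with 1_F
satisfies |h| <= 1_F' a.e., where F' = {|h| > 0} has the measure of F. *)
Lemma resonant_near_copy E F (e : R) : measurable E -> measurable F ->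
  mu F <= mu E -> mu E < +oo -> (0 < e)%R ->
  exists F', [/\ measurable F', mu F' = mu F & mu F <= mu (E `&` F') + e%:E].
Proof.
move=> mE mF FE Eoo e0.
have mi := @Mfun_indicator _ _ R _ mE; have mj := @Mfun_indicator _ _ R _ mF.
have Ffin : mu F \is a fin_num by rewrite ge0_fin_numE// (le_lt_trans FE).
have := hmu mi mj.
have -> : \int[lebesgue_measure]_(t in `[0%R, +oo[)
      (rearrangement mu (indicator R E) t * rearrangement mu (indicator R F) t)
      = mu F.
  have -> : mu F = \int[lebesgue_measure]_(t in `[0%R, +oo[)
      (\1_`[0%R, fine (mu F)[ t)%:E.
    rewrite integral_indic//= setIidl.
      rewrite lebesgue_measure_itv/= lte_fin; case: ltP => [_|F0].
        by rewrite sube0 fineK.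
      apply/eqP; rewrite eq_le measure_ge0 andbT -[mu F]fineK//.
    by move=> x /=; rewrite !in_itv/= => /andP[->].
  apply: eq_integral => t; rewrite inE /= in_itv/= andbT => t0.
  rewrite !rearrangement_indicator// indicE mem_setE in_itv/= t0 /=.
  rewrite -[in X in _ = X]lte_fin fineK//; case: (ltP t%:E (mu F)) => tF; last by rewrite mule0.
  by rewrite (lt_le_trans tF)// mul1e.
move=> supE; have : (mu F - e%:E) < mu F by rewrite lteBlDr// lteDl.
rewrite -{2}supE => /ereal_sup_gt [_ [h [mh hF] <-]] Fh.
have hdist s := fun s0 => equimeasurable_distribution mh mj hF (s:=s) s0.
have h0 := hdist _ (lexx 0%R); have h1 := hdist _ (ler01).
rewrite !distribution_indicator ?ltr01 ?ltxx// in h0 h1.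
have mF' := measurable_superlevel 0 mh.
exists [set x | 0 < eabs (h x)]; split => //.
rewrite -leeBlDr//; apply/ltW/(lt_le_trans Fh).
rewrite -[X in mu X]setIT -integral_indic//; last exact: measurableI.
apply: ae_ge0_le_integral => //.
- by move=> x _; rewrite mule_ge0// eabs_ge0.
- by apply: emeasurable_funM; exact: Mfun_eabs.
- apply/measurable_EFinP; apply: measurable_indic; exact: measurableI.
(* Outside the null set where |h| > 1, the product 1_E |h| is below the
   indicator of E and F'. *)
exists [set x | 1 < eabs (h x)]; split => //; first exact: measurable_superlevel.
move=> x xh; rewrite /mkset ltNge; apply/negP => h1x; apply: xh => _.
rewrite eabs_indicator !indicE in_setI; case: (x \in E); last by rewrite mul0e lee_fin.
rewrite mul1e /=; case: (boolP (_ \in _)) => //; rewrite notin_setE /= => /negP.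
by rewrite -leNgt.
Qed.

(** The approximate copies of [resonant_near_copy] are made exact by iteration.
A pair (E, F) with mu(F) <= mu(E) is replaced by (E \ F', F' \ E): the part of
E used up so far and the new F together still have measure mu(F), and the
measure of the latter tends to 0. *)
Lemma resonant_subset E F : measurable E -> measurable F ->
  mu F <= mu E -> mu E < +oo ->
  exists G, [/\ measurable G, G `<=` E & mu G = mu F].
Proof.
move=> mE mF FE Eoo.
(* The invariant of a pair: what is left of E, and a set whose measure is the
   amount still to be found there. *)
pose adm (p : set T * set T) :=
  [/\ measurable p.1, measurable p.2, mu p.2 <= mu p.1 & mu p.1 < +oo].
have /choice[copy copyP] : forall np : nat * (set T * set T), exists F', adm np.2 ->
    [/\ measurable F', mu F' = mu np.2.2 &
      mu np.2.2 <= mu (np.2.1 `&` F') + (np.1.+1%:R^-1)%:E].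
  move=> [n p]; have [[p1 p2 p12 poo]|np] := pselect (adm p); last by exists set0.
  by have [|F' F'P] := resonant_near_copy (e := n.+1%:R^-1) p1 p2 p12 poo => //; exists F'.
pose s := fix s n := if n is m.+1 then
  let F' := copy (m, s m) in ((s m).1 `\` F', F' `\` (s m).1) else (E, F).
have sS n : s n.+1 = ((s n).1 `\` copy (n, s n), copy (n, s n) `\` (s n).1) by [].
have sP n : [/\ adm (s n), (s n).1 `<=` E & mu (E `\` (s n).1) + mu (s n).2 = mu F].
  elim: n => [|n [adms sE IH]].
    by split => //=; rewrite setDv measure0 add0e.
  have [mF' F'F _] := copyP (n, s n) adms.
  rewrite [(n, s n).2]/= in F'F; case: adms => m1 m2 le12 fin1.
  have mI := measurableI _ _ m1 mF'; have mD1 := measurableD m1 mF'.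
  have mD2 := measurableD mF' m1.
  have e1 := measureDI mu m1 mF'; have e2 := measureDI mu mF' m1.
  rewrite [copy (n, s n) `&` _]setIC in e2.
  have finI : mu ((s n).1 `&` copy (n, s n)) \is a fin_num.
    rewrite ge0_fin_numE// (le_lt_trans _ fin1)// le_measure ?inE//; exact: subIsetl.
  rewrite sS /=; split; last first.
  - rewrite -IH -F'F e2 [mu (_ `\` (s n).1) + mu (_ `&` _)]addeC addeA; congr (_ + _).
    rewrite -measureU//; [|exact: measurableD|].
      congr (mu _); apply/seteqP; split => x /=.
        move=> [Ex /not_andP[sx|/contrapT F'x]]; first by left.
        by have [sx|sx] := pselect ((s n).1 x); [right|left].
      by move=> [[Ex sx]|[sx F'x]]; split => //; [case|exact: sE|case].
    by rewrite -subset0 => x [[_ /= ?] []].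
  - by move=> x [/sE].
  - split => //=.
      by rewrite -(leeD2rE _ _ finI) -e1 -e2; move: le12; rewrite -F'F.
    by rewrite (le_lt_trans _ fin1)// le_measure ?inE//; exact: subDsetl.
pose D n := E `\` (s n).1.
have mD n : measurable (D n) by apply: measurableD => //; have [[]] := sP n.
have ndD : nondecreasing_seq D.
  apply/nondecreasing_seqP => n; apply/subsetPset => x [Ex sx].
  by split => //; rewrite sS => -[].
exists (\bigcup_n D n); split; first exact: bigcup_measurable.
  by move=> x [n _ []].
have mG := bigcup_measurable (fun n (_ : True) => mD n).
have cvgD : mu \o D @ \oo --> mu (\bigcup_n D n) by exact: nondecreasing_cvg_mu.
have DF n : mu (D n) <= mu F by have [_ _ <-] := sP n; rewrite leeDl.
apply/eqP; rewrite eq_le; apply/andP; split.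
  rewrite -(cvg_lim _ cvgD)//; apply: lime_le; first by apply/cvg_ex; eexists; exact: cvgD.
  exact: nearW.
apply/lee_addgt0Pr => e e0.
have := truncnS_gt e^-1; set n := Num.truncn _ => en.
have [_ _ <-] := sP n.+1; apply: leeD.
  apply: le_measure; rewrite ?inE//; first exact: (mD n.+1).
  by move=> x Dx; exists n.+1.
have [[m1 m2 le12 fin1] _ _] := sP n.
(* The defect at stage n+1 is at most 1/(n+1), by the choice of the copy at
   stage n. *)
have [mF' F'F] := copyP (n, s n) (And4 m1 m2 le12 fin1); rewrite /= in F'F *.
rewrite -F'F (measureDI mu mF' m1) setIC addeC leeD2lE.
  by move=> /le_trans; apply; rewrite lee_fin invf_ple ?posrE// ltW.
rewrite ge0_fin_numE// (le_lt_trans _ fin1)// le_measure ?inE//.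
exact: measurableI.
Qed.

(** If mu(S) exceeds mu(B), a subset of S of measure mu(B) is split off, with B
itself as its copy; this can happen at most k times before the rest of S fits
into B. *)
Lemma split_copies k S B : measurable S -> measurable B -> mu B < +oo ->
  mu S <= k.+1%:R%:E * mu B ->
  exists Q P : nat -> set T, [/\ forall i, measurable (Q i) /\ measurable (P i),
    forall i, Q i `<=` S, forall i, P i `<=` B, forall i, mu (P i) = mu (Q i) &
    S `<=` \bigcup_(i < k.+1) Q i].
Proof.
move=> + mB Boo; elim: k S => [|k IH] S mS.
  rewrite mul1e => SB; have [P [mP PB PS]] := resonant_subset mB mS SB Boo.
  exists (fun=> S), (fun=> P); split=> [i|i|i|i|x Sx] //; last by exists 0%N.
move=> SB; have Bfin : mu B \is a fin_num by rewrite ge0_fin_numE.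
have Soo : mu S < +oo by rewrite (le_lt_trans SB)// -(fineK Bfin) -EFinM ltry.
have [{}SB0|/ltW BS] := leP (mu S) (mu B).
  have [P [mP PB PS]] := resonant_subset mB mS SB0 Boo.
  exists (fun=> S), (fun=> P); split=> [i|i|i|i|x Sx] //; last by exists 0%N.
have [Q0 [mQ0 Q0S Q0B]] := resonant_subset mS mB BS Soo.
have mSQ := measurableD mS mQ0.
have [|Q [P [mQP QS PB QP SQ]]] := IH _ mSQ.
  have SE : mu S = mu (S `\` Q0) + mu B.
    by rewrite -Q0B {1}(measureDI mu mS mQ0) (setIidr Q0S).
  rewrite -(leeD2rE _ _ Bfin) -SE (le_trans SB)// -(fineK Bfin).
  by rewrite -!EFinM -EFinD lee_fin -[in leLHS]natr1 mulrDl mul1r.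
exists (fun i => if i is j.+1 then Q j else Q0), (fun i => if i is j.+1 then P j else B).
split.
- by case.
- by case => // i x /QS[].
- by case.
- by case.
- move=> x Sx; have [Q0x|Q0x] := pselect (Q0 x); first by exists 0%N.
  by have [|i /= ik Qx] := SQ x; [split|exists i.+1].
Qed.

End resonant_copies.

(** * Dilation estimate for simple functions *)

Section dilation.
Local Open Scope ereal_scope.
Import HBNNSimple.
Context (d : measure_display) (T : measurableType d) (R : realType).
Variable mu : {measure set T -> \bar R}.
Implicit Types (N : (T -> ecomplex R) -> \bar R) (A : R -> set T).

Lemma Mplus_sum (m : nat) (F : nat -> T -> \bar R) : (forall i, Mplus (F i)) ->
  Mplus (fun x => \sum_(i < m) F i x).
Proof.
move=> MF; split; last by move=> x; apply: sume_ge0 => i _; exact: (MF i).2.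
by apply: emeasurable_sum => i; exact: (MF i).1.
Qed.

(** The constant depends on the number of summands but not on the summands,
which is what makes the final bound uniform over the iterates. *)
Lemma quasi_norm_sum_le N m : quasi_banach_norm mu N ->
  exists K : R, (0 <= K)%R /\ forall (F : nat -> T -> \bar R) (b : \bar R),
    (forall i, Mplus (F i)) -> (forall i, N (@of_ereal R \o F i) <= b) ->
    N (@of_ereal R \o (fun x => \sum_(i < m) F i x)) <= K%:E * b.
Proof.
move=> qN; elim: m => [|m [K [K0 IH]]].
  exists 0%R; split => // F b MF _; rewrite mul0e le_eqVlt; apply/orP; left; apply/eqP.
  by apply/(qn_eq0 qN (Mplus_sum 0 MF)); apply: aeW => x; rewrite big_ord0.
have [C [C1 CP]] := qn_triangle qN.
have C0 : (0 <= C)%R by rewrite (le_trans _ C1).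
exists (C * (K + 1))%R; split; first by rewrite mulr_ge0// addr_ge0.
move=> F b MF Fb.
have b0 : 0 <= b.
  by apply: le_trans (Fb 0%N); apply: (qn_ge0 qN); exact: Mfun_of_ereal (MF _).1.
under eq_fun do rewrite big_ord_recr/=.
rewrite (le_trans (CP _ _ (Mplus_sum m MF) (MF m)))//.
rewrite EFinM -muleA; apply: lee_wpmul2l; first by rewrite lee_fin.
by rewrite EFinD ge0_muleDl// mul1e leeD// IH.
Qed.

(** The functions |g| 1_(union of the A v) are made of pieces of the fibres of
g; in [ri_simple_comp_le], g is both f o psi and f. Their distribution depends
on the measures of the pieces only, see [distribution_fibres]. *)
Lemma superlevel_fibres (g : T -> R) (D : set R) A (s : R) :
  (forall v, A v `<=` g @^-1` [set v]) -> (0 <= s)%R ->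
  [set x | s%:E < eabs (of_ereal (`|g x| * \1_(\bigcup_(v in D) A v) x)%:E)] =
  \bigcup_(v in D `&` [set v | (s < `|v|)%R]) A v.
Proof.
move=> Ag s0; apply/seteqP; split => x.
  rewrite /mkset eabs_of_ereal ?lee_fin ?mulr_ge0// lte_fin indicE.
  case: (boolP (x \in _)) => [/set_mem [v Dv Avx]|_]; last by rewrite mulr0 ltNge s0.
  by rewrite mulr1 => sg; exists v => //; split => //=; rewrite -(Ag v x Avx).
move=> [v [Dv sv] Avx]; rewrite /mkset eabs_of_ereal ?lee_fin ?mulr_ge0// lte_fin indicE.
by rewrite mem_set ?mulr1 ?(Ag v x Avx)//; exists v.
Qed.

Lemma distribution_fibres (g : T -> R) (D : set R) A (s : R) :
  finite_set D -> (forall v, D v -> measurable (A v)) ->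
  (forall v, A v `<=` g @^-1` [set v]) -> (0 <= s)%R ->
  distribution_fun mu
    (@of_ereal R \o (fun x => (`|g x| * \1_(\bigcup_(v in D) A v) x)%:E)) s =
  \sum_(v \in D `&` [set v | (s < `|v|)%R]) mu (A v).
Proof.
move=> finD mA Ag s0; rewrite /distribution_fun.
rewrite (superlevel_fibres D Ag s0).
rewrite measure_fin_bigcup//.
- exact: finite_setIl.
- by move=> v w _ _ [x [/Ag <- /Ag <-]].
- by move=> v [Dv _]; exact: mA.
Qed.

Hypothesis hmu : resonant mu.

(** On each fibre of f over v != 0, [split_copies] covers the corresponding fibre
of f o psi by k+1 pieces with copies in the fibre of f. Collecting the i-th
pieces over all v gives a function equimeasurable with one below f. *)
Lemma ri_simple_comp_le N k : quasi_banach_norm mu N -> rearrangement_invariant mu N ->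
  exists K : R, (0 <= K)%R /\ forall psi : T -> T, measurable_fun [set: T] psi ->
    (forall E, measurable E -> mu (psi @^-1` E) <= k.+1%:R%:E * mu E) ->
    forall f : {nnsfun T >-> R}, mu [set x | f x != 0%R] < +oo ->
      N (@of_ereal R \o (fun x => (f (psi x))%:E)) <=
      K%:E * N (@of_ereal R \o (fun x => (f x)%:E)).
Proof.
move=> qN riN; have [K [K0 KP]] := quasi_norm_sum_le k.+1 qN.
exists K; split => // psi mpsi psik f foo.
have mB v : measurable (f @^-1` [set v]) by exact: measurable_sfunP.
have mS v : measurable (psi @^-1` (f @^-1` [set v])).
  by rewrite -[X in measurable X]setTI; exact: mpsi.
have /choice[QP QPP] : forall v : R, exists QP : (nat -> set T) * (nat -> set T),
    v != 0%R -> [/\ forall i, measurable (QP.1 i) /\ measurable (QP.2 i),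
    forall i, QP.1 i `<=` psi @^-1` (f @^-1` [set v]),
    forall i, QP.2 i `<=` f @^-1` [set v], forall i, mu (QP.2 i) = mu (QP.1 i) &
    psi @^-1` (f @^-1` [set v]) `<=` \bigcup_(i < k.+1) QP.1 i].
  move=> v; have [v0|v0] := eqVneq v 0%R; first by exists (fun=> set0, fun=> set0).
  have Boo : mu (f @^-1` [set v]) < +oo.
    rewrite (le_lt_trans _ foo)// le_measure ?inE//; last by move=> x /= ->.
    rewrite (_ : [set _ | _] = ~` (f @^-1` [set 0%R])); first exact: measurableC.
    by apply/seteqP; split => x /= /eqP.
  have [Q [P QPv]] := split_copies hmu (mS v) (mB v) Boo (psik _ (mB v)).
  by exists (Q, P).
(* The fibre over 0 may have infinite measure; it contributes nothing to f and
   its pieces are taken empty. *)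
pose D := range f `\ 0%R.
have finD : finite_set D by apply: sub_finite_set (fimfunP f); exact: subDsetl.
pose Q i (v : R) := if v == 0%R then set0 else (QP v).1 i.
pose P i (v : R) := if v == 0%R then set0 else (QP v).2 i.
have mQ i (v : R) : measurable (Q i v).
  by rewrite /Q; case: ifPn => // v0; have [/(_ i)[]] := QPP v v0.
have mP i (v : R) : measurable (P i v).
  by rewrite /P; case: ifPn => // v0; have [/(_ i)[]] := QPP v v0.
have QS i v : Q i v `<=` (f \o psi) @^-1` [set v].
  by rewrite /Q; case: ifPn => [_ x//|v0]; have [_ /(_ i)] := QPP v v0.
have PB i v : P i v `<=` f @^-1` [set v].
  by rewrite /P; case: ifPn => [_ x//|v0]; have [_ _ /(_ i)] := QPP v v0.
have PQ i v : mu (P i v) = mu (Q i v).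
  by rewrite /P /Q; case: ifPn => // v0; have [_ _ _ /(_ i)] := QPP v v0.
pose F i x := (`|f (psi x)| * \1_(\bigcup_(v in D) Q i v) x)%:E.
pose H i x := (`|f x| * \1_(\bigcup_(v in D) P i v) x)%:E.
have mfpsi : measurable_fun [set: T] (f \o psi) by exact: measurableT_comp.
have MF i : Mplus (F i).
  split; last by move=> x; rewrite lee_fin mulr_ge0.
  apply/measurable_EFinP; apply: measurable_funM.
    exact: measurableT_comp.
  by apply: measurable_indic; apply: fin_bigcup_measurable.
have MH i : Mplus (H i).
  split; last by move=> x; rewrite lee_fin mulr_ge0.
  apply/measurable_EFinP; apply: measurable_funM.
    exact: measurableT_comp.
  by apply: measurable_indic; apply: fin_bigcup_measurable.
have Mf : Mplus (fun x => (f x)%:E).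
  by split => [|x]; [exact/measurable_EFinP|rewrite lee_fin].
have Mfpsi : Mplus (fun x => (f (psi x))%:E).
  by split => [|x]; [exact/measurable_EFinP|rewrite lee_fin].
apply: le_trans (KP F _ MF _); last first.
  move=> i; rewrite (riN _ (@of_ereal R \o H i)).
  - apply: (qn_P2 qN) => //; apply: aeW => x; rewrite lee_fin ger0_norm//.
    by rewrite ler_piMr// indicE; case: (_ \in _).
  - exact: Mfun_of_ereal (MF i).1.
  - exact: Mfun_of_ereal (MH i).1.
  - apply: distribution_equimeasurable => s s0.
    rewrite (distribution_fibres (g := f \o psi) finD (fun v _ => mQ i v) (QS i) s0).
    rewrite (distribution_fibres finD (fun v _ => mP i v) (PB i) s0).
    by apply: eq_fsbigr => v _; rewrite PQ.
apply: (qn_P2 qN) => //; first exact: Mplus_sum.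
apply: aeW => x.
have sum0 : 0 <= \sum_(i < k.+1) F i x by apply: sume_ge0 => i _; exact: (MF i).2.
have [->|fx0] := eqVneq (f (psi x)) 0%R; first by [].
have [_ _ _ _ /(_ x erefl)[i /= ik Qx]] := QPP _ fx0.
rewrite (bigD1 (Ordinal ik))//= {1}/F indicE mem_set; last first.
  exists (f (psi x)); first by split; [exists (psi x)|exact/eqP].
  by rewrite /Q (negbTE fx0).
rewrite mulr1 ger0_norm// leeDl//; apply: sume_ge0 => j _; exact: (MF j).2.
Qed.

End dilation.

(** * Power-boundedness on rearrangement-invariant spaces *)

Section power_bounded_ri.
Local Open Scope ereal_scope.
Import HBNNSimple.
Context (d : measure_display) (T : measurableType d) (R : realType).
Variable mu : {sigma_finite_measure set T -> \bar R}.
Implicit Types (N : (T -> ecomplex R) -> \bar R) (f g h : T -> ecomplex R).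

(** Sigma-finiteness enters here: the standard simple approximations are cut
off to an exhausting sequence of sets of finite measure. *)
Lemma cvg_simple_finite_support (f : T -> \bar R) : Mplus f ->
  exists u : {nnsfun T >-> R}^nat,
  [/\ forall n, mu [set x | u n x != 0%R] < +oo,
      forall x, nondecreasing_seq (fun n => (u n x)%:E) &
      forall x, (u n x)%:E @[n --> \oo] --> f x].
Proof.
move=> [mf f0].
have /sigma_finiteP[F [FT ndF /all_and2[mF Foo]]] := sigma_finiteT mu.
pose a := nnsfun_approx measurableT mf.
exists (fun n => mul_nnsfun (a n) (indic_nnsfun R (mF n))); split.
- move=> n; apply: le_lt_trans (Foo n); apply: le_measure; rewrite ?inE//.
  + rewrite (_ : [set _ | _] =
        ~` (mul_nnsfun (a n) (indic_nnsfun R (mF n)) @^-1` [set 0%R])).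
      by apply: measurableC; exact: measurable_sfunP.
    by apply/seteqP; split => x /= /eqP.
  + move=> x /=; rewrite /mindic indicE; case: (boolP (x \in _)) => [/set_mem//|_].
    by rewrite mulr0 eqxx.
- move=> x m n mn; rewrite lee_fin /= ler_pM//.
    by have /lefP := nd_nnsfun_approx measurableT mf mn; exact.
  rewrite /mindic !indicE; case: (boolP (x \in F m)) => // /set_mem Fx.
  by rewrite mem_set//; have /subsetPset := ndF _ _ mn; exact.
- move=> x; have ax := cvg_nnsfun_approx measurableT mf (fun x _ => f0 x) (I : setT x).
  have [m _ Fmx] : (\bigcup_i F i) x by rewrite -FT.
  apply: cvg_trans ax; apply: near_eq_cvg; near=> n => /=.
  rewrite /mindic indicE mem_set ?mulr1//.
  have mn : (m <= n)%N by near: n; exists m.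
  by have /subsetPset := ndF _ _ mn; exact.
Unshelve. all: by end_near. Qed.

Hypothesis hmu : resonant mu.

Lemma ri_comp_le N k : quasi_banach_norm mu N -> rearrangement_invariant mu N ->
  exists K : R, (0 <= K)%R /\ forall psi : T -> T, measurable_fun [set: T] psi ->
    (forall E, measurable E -> mu (psi @^-1` E) <= k.+1%:R%:E * mu E) ->
    forall f, Mfun f -> N (f \o psi) <= K%:E * N f.
Proof.
move=> qN riN; have [K [K0 KP]] := ri_simple_comp_le hmu k qN riN.
exists K; split => // psi mpsi psik f mf.
have mfpsi : Mfun (f \o psi) by exact: measurableT_comp.
rewrite -(qn_abs qN mf) -(qn_abs qN mfpsi).
have [u [uoo ndu cvgu]] := cvg_simple_finite_support (Mplus_eabs mf).
have Mu n : Mplus (fun x => (u n x)%:E).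
  by split => [|x]; [exact/measurable_EFinP|rewrite lee_fin].
have Mupsi n : Mplus (fun x => (u n (psi x))%:E).
  split => [|x]; last by rewrite lee_fin.
  by apply/measurable_EFinP; exact: measurableT_comp.
have [_ Ncvg] := qn_P3 qN Mupsi (Mplus_eabs mfpsi)
  (aeW _ (fun x => conj (ndu (psi x)) (cvgu (psi x)))).
rewrite -(cvg_lim _ Ncvg)//; apply: lime_le.
  by apply/cvg_ex; eexists; exact: Ncvg.
apply: nearW => n; apply: le_trans (KP _ mpsi psik (u n) (uoo n)) _.
apply: lee_wpmul2l; first by rewrite lee_fin.
apply: (qn_P2 qN) => //; first exact: Mplus_eabs.
apply: aeW => x; rewrite -(cvg_lim _ (cvgu x))//.
rewrite (cvg_lim _ (ereal_nondecreasing_cvgn (ndu x)))//.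
by apply: ereal_sup_ubound; exists n.
Qed.

Lemma iter_composition_operator (phi : T -> T) n f :
  iter n (@composition_operator d T R phi) f = f \o iter n phi.
Proof.
by elim: n f => [//|n IH] f; rewrite iterSr IH.
Qed.

(** The bound for phi^n does not deteriorate with n because the constant in
[ri_comp_le] depends on the iterate only through A. *)
Lemma power_measure_bounded_ri (phi : T -> T) N : measurable_fun [set: T] phi ->
  power_measure_bounded mu phi ->
  quasi_banach_norm mu N -> rearrangement_invariant mu N ->
  power_bounded mu N (@composition_operator d T R phi).
Proof.
move=> mphi [A [A0 PA]] qN riN.
have mphin n : measurable_fun [set: T] (iter n phi).
  by elim: n => [|n IH]; [exact: measurable_id|exact: measurableT_comp].
pose k := Num.truncn A.
have Ak : (A <= k.+1%:R)%R by rewrite ltW// truncnS_gt.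
have phik n E : measurable E -> mu (iter n phi @^-1` E) <= k.+1%:R%:E * mu E.
  move=> mE; case: n => [|n].
    by rewrite -[leLHS]mul1e lee_wpmul2r// lee_fin ler1n.
  by rewrite (le_trans (PA n.+1 E _ mE))// lee_wpmul2r// lee_fin.
have [K [K0 KP]] := ri_comp_le k qN riN.
split.
- move=> f g _ _ [Z [mZ Z0 fgZ]]; exists (phi @^-1` Z); split.
  + by rewrite -[X in measurable X]setTI; exact: mphi.
  + by apply/eqP; rewrite -measure_le0 (le_trans (phik 1%N _ mZ))// Z0 mule0.
  + by move=> x /= fg; apply: fgZ => /= e; apply: fg; rewrite /composition_operator/=.
- move=> f [mf foo]; split; first exact: measurableT_comp.
  have N0 := qn_ge0 qN mf.
  rewrite (le_lt_trans (KP _ (mphin 1%N) (phik 1%N) f mf))//.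
  by rewrite lte_mul_pinfty// lee_fin.
- apply: (@le_lt_trans _ _ K%:E); last exact: ltry.
  apply: ge_ereal_sup => _ [n _ <-]; apply: ge_ereal_sup => _ [f [[mf foo] f1] <-].
  rewrite iter_composition_operator (le_trans (KP _ (mphin n) (phik n) f mf))//.
  by rewrite -[leRHS]mule1 lee_wpmul2l// lee_fin.
Qed.

End power_bounded_ri.

(** * The space of integrable functions *)

Section L1.
Local Open Scope ereal_scope.
Context (d : measure_display) (T : measurableType d) (R : realType).
Variable mu : {measure set T -> \bar R}.
Implicit Types (f g h : T -> ecomplex R).

Lemma L1norm_of_ereal (f : T -> \bar R) : (forall x, 0 <= f x) ->
  L1norm mu (@of_ereal R \o f) = \int[mu]_x f x.
Proof. by move=> f0; apply: eq_integral => x _; exact: eabs_of_ereal. Qed.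

(** Property (P3) is monotone convergence on the complement of the exceptional
null set. *)
Lemma L1norm_quasi_banach : quasi_banach_norm mu (L1norm mu).
Proof.
split.
- by move=> f mf; apply: integral_ge0 => x _; exact: eabs_ge0.
- by move=> f mf; rewrite L1norm_of_ereal// => x; exact: eabs_ge0.
- move=> a f a0 [mf f0]; rewrite !L1norm_of_ereal//; last first.
    by move=> x; rewrite mule_ge0.
  exact: ge0_integralZl_EFin.
- move=> f [mf f0]; rewrite L1norm_of_ereal//.
  have -> : \int[mu]_x f x = \int[mu]_x `|f x|.
    by apply: eq_integral => x _; rewrite gee0_abs.
  rewrite ae_eq_integral_abs//; split=> [|fae]; last exact: filterS fae.
  by apply: filterS => x; exact.
- exists 1%R; split => // f g [mf f0] [mg g0]; rewrite !L1norm_of_ereal//; last first.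
    by move=> x; rewrite adde_ge0.
  by rewrite mul1e ge0_integralD.
- move=> f g [mf f0] [mg g0] fg; rewrite !L1norm_of_ereal//.
  by apply: ae_ge0_le_integral => //; apply: filterS fg.
- move=> u f Mu [mf f0] [Z [mZ Z0 uZ]].
  have {}uZ x : (~` Z) x -> nondecreasing_seq (u ^~ x) /\ u n x @[n --> \oo] --> f x.
    by move=> nZx; apply: contrapT => /uZ.
  have mZC := measurableC mZ.
  have mu_ n : measurable_fun (~` Z) (u n) by exact: measurable_funS (Mu n).1.
  have intZ (g : T -> \bar R) : Mplus g ->
      L1norm mu (@of_ereal R \o g) = \int[mu]_(x in ~` Z) g x.
    by move=> [mg g0]; rewrite L1norm_of_ereal// (ge0_negligible_integral _ _ _ _ Z0)// setTD.
  under eq_fun do rewrite intZ//.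
  rewrite intZ//; split.
    move=> m n mn; apply: ge0_le_integral => //; first by move=> x _; exact: (Mu m).2.
    by move=> x /uZ[ndu _]; exact: ndu.
  have -> : \int[mu]_(x in ~` Z) f x = \int[mu]_(x in ~` Z) limn (u ^~ x).
    by apply: eq_integral => x /set_mem /uZ[_ /cvg_lim ->].
  apply: cvg_monotone_convergence => //; first by move=> n x _; exact: (Mu n).2.
  by move=> x /uZ[].
- move=> E mE Eoo; rewrite L1norm_of_ereal; last by move=> x; rewrite lee_fin.
  by rewrite integral_indic// setIT.
Qed.

Lemma L1norm_indicator E : measurable E -> L1norm mu (indicator R E) = mu E.
Proof.
move=> mE; rewrite /L1norm; under eq_integral do rewrite eabs_indicator.
by rewrite integral_indic// setIT.
Qed.

(** In the resonance identity for f and the constant 1, every competitor h has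
|h| <= 1 a.e., so the supremum is attained at 1 itself. *)
Lemma resonant_L1norm f : resonant mu -> Mfun f ->
  L1norm mu f = \int[lebesgue_measure]_(t in `[0%R, +oo[)
    (rearrangement mu f t * rearrangement mu (indicator R [set: T]) t).
Proof.
move=> hmu mf; have m1 := @Mfun_indicator _ T R _ measurableT.
rewrite -(hmu _ _ mf m1); apply/eqP; rewrite eq_le; apply/andP; split.
  apply: ereal_sup_ubound; exists (indicator R [set: T]) => //.
  by apply: eq_integral => x _; rewrite eabs_indicator indicT mule1.
apply: ge_ereal_sup => _ [h [mh h1] <-].
have mE := Mfun_eabs mf; have mE' := Mfun_eabs mh.
apply: ae_ge0_le_integral => //.
- by move=> x _; rewrite mule_ge0// eabs_ge0.
- exact: emeasurable_funM.
- by move=> x _; exact: eabs_ge0.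
have := equimeasurable_distribution mh m1 h1 (s:=1) ler01.
rewrite distribution_indicator// ltxx => h10.
exists [set x | 1 < eabs (h x)]; split => //; first exact: measurable_superlevel.
move=> x xh; rewrite /mkset ltNge; apply/negP => h1x; apply: xh => _.
by rewrite -[leRHS]mule1 lee_wpmul2l// eabs_ge0.
Qed.

Lemma L1norm_rearrangement_invariant :
  resonant mu -> rearrangement_invariant mu (L1norm mu).
Proof.
move=> hmu f g mf mg fg; rewrite !resonant_L1norm//.
by apply: eq_integral => t; rewrite inE /= in_itv/= andbT => t0; rewrite fg.
Qed.

(** The function 1_E / r has norm at most 1 for every real r > 0 with
r >= mu(E), hence mu(phi^-n E) <= A r; letting r decrease to mu(E) covers null
sets as well. *)
Lemma L1_power_bounded_measure (phi : T -> T) : measurable_fun [set: T] phi ->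
  power_bounded mu (L1norm mu) (@composition_operator d T R phi) ->
  power_measure_bounded mu phi.
Proof.
move=> mphi [_ _ supoo].
have mphin n : measurable_fun [set: T] (iter n phi).
  by elim: n => [|n IH]; [exact: measurable_id|exact: measurableT_comp].
set M := ereal_sup _ in supoo.
have le_M n f : Defs.space (L1norm mu) f -> L1norm mu f <= 1 ->
    L1norm mu (f \o iter n phi) <= M.
  move=> fs f1; rewrite -iter_composition_operator.
  apply: le_ereal_sup_tmp.
  exists (opnorm (L1norm mu) (iter n (@composition_operator d T R phi))).
    by exists n.
  by apply: ereal_sup_ubound; exists f.
have M0 : 0 <= M.
  have s0 : Defs.space (L1norm mu) (indicator R set0).
    by split; [exact: Mfun_indicator|rewrite L1norm_indicator// measure0].
  apply: le_trans (le_M 0%N _ s0 _); last by rewrite L1norm_indicator// measure0 lee_fin.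
  exact: (qn_ge0 L1norm_quasi_banach s0.1).
have [A A0 MA] : exists2 A : R, (0 < A)%R & M <= A%:E.
  exists (fine M + 1)%R; first by rewrite ltr_wpDl// fine_ge0.
  by rewrite EFinD fineK ?ge0_fin_numE// leeDl.
exists A; split => // n E _ mE.
have [->|] := eqVneq (mu E) +oo; first by rewrite gt0_muley ?lte_fin// leey.
rewrite -ltey => Eoo.
have key (r : R) : (0 < r)%R -> mu E <= r%:E -> mu (iter n phi @^-1` E) <= (A * r)%:E.
  move=> r0 Er.
  pose f : T -> ecomplex R := @of_ereal R \o (fun x => (r^-1)%:E * (\1_E x)%:E).
  have mi : Mplus (fun x => (\1_E x : R)%:E).
    by split => [|x]; [apply/measurable_EFinP; exact: measurable_indic|rewrite lee_fin].
  have r10 : (0 <= r^-1)%R by rewrite invr_ge0 ltW.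
  have fE : L1norm mu f = (r^-1)%:E * mu E.
    by rewrite (qn_homo L1norm_quasi_banach r10 mi) L1norm_indicator.
  have f1 : L1norm mu f <= 1.
    rewrite fE; apply: le_trans (lee_wpmul2l _ Er) _; first by rewrite lee_fin.
    by rewrite -EFinM mulVf// gt_eqF.
  have mE' : measurable (iter n phi @^-1` E).
    by rewrite -[X in measurable X]setTI; exact: mphin.
  have sf : Defs.space (L1norm mu) f.
    split; last by rewrite (le_lt_trans f1)// ltry.
    by apply: Mfun_of_ereal; apply: emeasurable_funM => //; exact: mi.1.
  have := le_trans (le_M n f sf f1) MA.
  have -> : f \o iter n phi =
      @of_ereal R \o (fun x => (r^-1)%:E * (\1_(iter n phi @^-1` E) x)%:E) by [].
  rewrite (qn_homo L1norm_quasi_banach r10); last first.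
    by split => [|x]; [apply/measurable_EFinP; exact: measurable_indic|rewrite lee_fin].
  rewrite L1norm_indicator// => le1.
  by rewrite mulrC EFinM -lee_pdivrMl.
have Efin : mu E \is a fin_num by rewrite ge0_fin_numE.
apply/lee_addgt0Pr => e e0.
have eA : (0 < e / A)%R by rewrite divr_gt0.
have -> : A%:E * mu E + e%:E = (A * (fine (mu E) + e / A))%:E.
  by rewrite mulrDr EFinD EFinM fineK// mulrCA divff ?mulr1// gt_eqF.
apply: key; first by rewrite ltr_wpDl ?fine_ge0.
by rewrite EFinD fineK// leeDl// lee_fin ltW.
Qed.

End L1.

Theorem theorem3p21 (d : measure_display) (T : measurableType d) (R : realType)
  (mu : {sigma_finite_measure set T -> \bar R}) (hmu : resonant mu)
  (phi : T -> T) (hphi : measurable_fun [set: T] phi) :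
  [<-> power_measure_bounded mu phi;
       power_bounded mu (L1norm mu) (@composition_operator d T R phi);
       forall N : (T -> ecomplex R) -> \bar R,
         quasi_banach_norm mu N -> rearrangement_invariant mu N ->
         power_bounded mu N (@composition_operator d T R phi)].
Proof.
have L1N := L1norm_quasi_banach mu.
have L1ri := L1norm_rearrangement_invariant hmu.
tfae.
- by move=> pmb; exact: power_measure_bounded_ri.
- move=> pb N qN riN; apply: power_measure_bounded_ri => //.
  exact: L1_power_bounded_measure.
- by move=> pbN; apply: L1_power_bounded_measure => //; exact: pbN.
Qed.
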